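(* Let $n=p+q$, let $h^1,\dots,h^n:\mathbb{R}^{p,q}\to\mathcal{C}\ell_{\circledS}(p,q)$ be a Clifford field vector and $C_1,\dots,C_n:\mathbb{R}^{p,q}\to\mathcal{C}\ell_{\circledS}(p,q)$ be functions (all with continuous partial derivatives up to second order) such that $$\partial_\mu h^\nu-[C_\mu,h^\nu]=0\quad\text{for all }\mu,\nu=1,\dots,n.$$ Then $$\partial_\mu C_\nu-\partial_\nu C_\mu-[C_\mu,C_\nu]=0\quad\text{for all }\mu,\nu=1,\dots,n.$$ Moreover, these conditions are gauge invariant: if $C_\mu$ satisfy them and $S:\mathbb{R}^{p,q}\to\mathcal{C}\ell(p,q)$ is a smooth function with invertible values such that $S^{-1}\partial_\mu S\in\mathcal{C}\ell_{\circledS}(p,q)$ for all $\mu$, then $\acute C_\mu=S^{-1}C_\mu S-S^{-1}\partial_\mu S$ also satisfy $\partial_\mu \acute C_\nu-\partial_\nu \acute C_\mu-[\acute C_\mu,\acute C_\nu]=0$ for all $\mu,\nu$.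
   Context: $\mathbb{R}^{p,q}$ is $\mathbb{R}^n$ with Cartesian coordinates $x^\mu$, $\partial_\mu=\partial/\partial x^\mu$, metric $\eta=\mathrm{diag}(1,\dots,1,-1,\dots,-1)$ ($p$ ones, $q$ minus ones). $\mathcal{C}\ell(p,q)$ is the complex Clifford algebra with identity $e$ and generators $e^1,\dots,e^n$, $e^ae^b+e^be^a=2\eta^{ab}e$, with basis $e$, $e^{a_1\dots a_k}=e^{a_1}\cdots e^{a_k}$ ($a_1<\dots<a_k$); functions into it are differentiated coefficientwise. $[U,V]=UV-VU$. $\pi_k$ is the projection onto the span of the basis elements with $k$ indices, $\mathrm{Tr}(U)$ the coefficient of $e$. The center is $\mathcal{C}\ell_0$ for even $n$ and $\mathcal{C}\ell_0\oplus\mathcal{C}\ell_n$ for odd $n$; $\mathcal{C}\ell_{\circledS}(p,q)$ is the set of elements with zero projection onto the center. A Clifford field vector is a collection $h^\mu:\mathbb{R}^{p,q}\to\mathcal{C}\ell(p,q)$, $\mu=1,\dots,n$, with $h^\mu h^\nu+h^\nu h^\mu=2\eta^{\mu\nu}e$ and $\mathrm{Tr}(h^1\cdots h^n)=0$ at every point. *)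

(* Defs.v *)
From HB Require Import structures.
From mathcomp Require Import all_boot all_order all_algebra.
From mathcomp Require Import all_classical all_reals all_analysis.
From mathcomp Require complex.
Import complex.ComplexField.
Set Implicit Arguments. Unset Strict Implicit. Unset Printing Implicit Defensive.
Import Order.TTheory GRing.Theory Num.Theory.
Import numFieldNormedType.Exports.
Local Open Scope ring_scope.

Section Clifford.
Variables (R : realType) (p q : nat).

Notation CC := (complex.complex R).

Notation I := 'I_(p + q).

(* complex Clifford algebra Cl(p,q): coefficient functions on the basis
   e^{A} = e^{a_1}...e^{a_k}, A = {a_1 < ... < a_k} a subset of indices. *)
Definition cl := {ffun {set I} -> CC}.

Definition eta (a b : I) : CC :=
  if a == b then (if (a < p)%N then 1 else -1) else 0.

(* e^A e^B = sgn(A,B) e^{A Δ B}, with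
   sgn(A,B) = (-1)^{#{(a,b) in A x B | b < a}} * prod_{c in A ∩ B} eta(c,c) *)
Definition blade_sign (A B : {set I}) : CC :=
  (-1) ^+ #|[set ab : I * I | (ab.1 \in A) && (ab.2 \in B) && (ab.2 < ab.1)%N]|
  * \prod_(c in A :&: B) eta c c.

Definition symdiff (A B : {set I}) : {set I} := (A :\: B) :|: (B :\: A).

Definition clmul (U V : cl) : cl :=
  [ffun C => \sum_(A : {set I}) \sum_(B : {set I} | symdiff A B == C)
               blade_sign A B * (U A * V B)].

Definition clunit : cl := [ffun A => if A == @finset.set0 I then 1 else 0].
Definition clgen (a : I) : cl := [ffun A => if A == finset.set1 a then 1 else 0].

Definition clcomm (U V : cl) : cl := clmul U V - clmul V U.

Definition clTr (U : cl) : CC := U (@finset.set0 I).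

(* Cl_circledS(p,q): zero projection onto the center, which is Cl_0 for even n
   and Cl_0 ⊕ Cl_n for odd n. *)
Definition in_clS (U : cl) : Prop :=
  U (@finset.set0 I) = 0 /\ (odd (p + q) -> U ((finset.setTfor I)) = 0).

Definition clprod (h : I -> cl) : cl :=
  foldr clmul clunit [seq h i | i <- enum I].

Definition Rpq := 'rV[R]_(p + q).
Definition dir (mu : I) : Rpq := delta_mx 0 mu.

Definition rpartial (mu : I) (f : Rpq -> R) : Rpq -> R :=
  fun x => 'D_(dir mu) f x.

Fixpoint rCk (k : nat) (f : Rpq -> R) : Prop :=
  match k with
  | 0 => continuous f
  | k'.+1 => continuous f /\ (forall mu x, derivable f x (dir mu)) /\
             (forall mu, rCk k' (rpartial mu f))
  end.

Definition coefRe (F : Rpq -> cl) (A : {set I}) : Rpq -> R :=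
  fun x => complex.Re (F x A).
Definition coefIm (F : Rpq -> cl) (A : {set I}) : Rpq -> R :=
  fun x => complex.Im (F x A).

Definition clpartial (mu : I) (F : Rpq -> cl) : Rpq -> cl :=
  fun x => [ffun A => complex.Complex (rpartial mu (coefRe F A) x)
                                      (rpartial mu (coefIm F A) x)].

Definition clCk (k : nat) (F : Rpq -> cl) : Prop :=
  forall A, rCk k (coefRe F A) /\ rCk k (coefIm F A).

Definition clsmooth (F : Rpq -> cl) : Prop := forall k, clCk k F.

Definition clifford_field_vector (h : I -> Rpq -> cl) : Prop :=
  forall x,
    (forall mu nu, clmul (h mu x) (h nu x) + clmul (h nu x) (h mu x)
                   = [ffun A => if A == @finset.set0 I then 2 * eta mu nu else 0])
    /\ clTr (clprod (fun i => h i x)) = 0.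

Definition zero_curvature (C : I -> Rpq -> cl) : Prop :=
  forall mu nu x,
    clpartial mu (C nu) x - clpartial nu (C mu) x - clcomm (C mu x) (C nu x) = 0.

End Clifford.

(* Main.v *)
Require Import Defs.
From HB Require Import structures.
From mathcomp Require Import all_boot all_order all_algebra.
From mathcomp Require Import all_classical all_reals all_analysis.
From mathcomp Require Import ring lra.
From mathcomp Require Import complex.
Import complex.ComplexField.
Import Order.TTheory GRing.Theory Num.Theory.
Import numFieldNormedType.Exports.
Local Open Scope ring_scope.
Set Implicit Arguments. Unset Strict Implicit. Unset Printing Implicit Defensive.

(* Differentiating d_mu h^rho = [C_mu, h^rho] once more and using the symmetry of
   second derivatives gives [K_{mu nu}, h^rho] = 0 for the curvature K of C.  The
   ordered products of the h^rho over index sets are orthogonal for the trace form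
   (U, V) |-> Tr (U V), Tr (h^1 ... h^n) = 0 being needed only for complementary
   sets with n odd; so they form a basis and K is central.  Its central component
   vanishes because those of the C_mu and of commutators do, hence K = 0.
   Under a gauge transformation the curvature becomes S^-1 K S, where the
   differentiability of S^-1 follows from S^-1(y) - S^-1(x) =
   - S^-1(y) (S(y) - S(x)) S^-1(x) and the boundedness of S^-1 near x. *)

(** * The Clifford algebra in the blade basis: signs, product, trace and center *)

Section CliffordAlgebra.
Variables (R : realType) (p q : nat).
Local Notation CC := (complex.complex R).
Local Notation I := 'I_(p + q).
Local Notation cl := (cl R p q).
Local Notation one := (clunit R p q).
Implicit Types (a b c : I) (A B C : {set I}) (U V W : cl) (w s t : seq I).

(** The contribution of one pair to the sign of a product of blades: a transposition costs -1, a
    contraction gives [eta a a]. *)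
Definition pair_sign a b : CC :=
  if (b < a)%N then -1 else if a == b then Defs.eta R a b else 1.

Lemma pair_sign_sqr a b : pair_sign a b * pair_sign a b = 1.
Proof.
rewrite /pair_sign /Defs.eta; case: ifP => _; first by rewrite mulrNN mulr1.
case: eqP => _; last by rewrite mulr1.
by case: ifP => _; rewrite ?mulrNN mulr1.
Qed.

(* As every pair sign squares to 1, this form makes the sign bimultiplicative
   for the symmetric difference; associativity of clmul follows. *)
Lemma blade_signE A B :
  blade_sign R A B = \prod_(a in A) \prod_(b in B) pair_sign a b.
Proof.
rewrite pair_big_dep /= (bigID (fun ab : I * I => (ab.2 < ab.1)%N)) /=.
rewrite (eq_bigr (fun _ => -1 : CC)); last first.
  by move=> [a b] /= /andP[_ ab]; rewrite /pair_sign ab.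
rewrite prodr_const; congr (_ * _).
  by congr (_ ^+ _); rewrite cardsE; apply: eq_card => -[a b].
rewrite (bigID (fun ab : I * I => ab.1 == ab.2)) /= [X in _ = _ * X]big1; last first.
  by move=> [a b] /= /andP[/andP[_ h1] h2]; rewrite /pair_sign (negbTE h1) (negbTE h2).
rewrite mulr1 (reindex_onto (fun c => (c, c)) (fun ab : I * I => ab.1)) /=; last first.
  by move=> [a b] /= /andP[_ /eqP ->].
apply: eq_big => [c|c _]; last by rewrite /pair_sign ltnn eqxx.
by rewrite inE ltnn !eqxx !andbT.
Qed.

Lemma in_symdiff A B c : (c \in symdiff A B) = (c \in A) (+) (c \in B).
Proof. by rewrite !inE; case: (c \in A); case: (c \in B). Qed.

Lemma symdiffC A B : symdiff A B = symdiff B A.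
Proof. by apply/setP => c; rewrite !in_symdiff addbC. Qed.

Lemma symdiffA A B C : symdiff A (symdiff B C) = symdiff (symdiff A B) C.
Proof. by apply/setP => c; rewrite !in_symdiff addbA. Qed.

Lemma symdiff0 A : symdiff A finset.set0 = A.
Proof. by apply/setP => c; rewrite in_symdiff inE addbF. Qed.

Lemma symdiffK A B : symdiff A (symdiff A B) = B.
Proof. by apply/setP => c; rewrite !in_symdiff addKb. Qed.

Lemma symdiff_eq A B C : (symdiff A B == C) = (B == symdiff A C).
Proof. by apply/eqP/eqP => [<-|->]; rewrite symdiffK. Qed.

Lemma prod_symdiff (f : I -> CC) A B : (forall c, f c * f c = 1) ->
  \prod_(c in symdiff A B) f c = (\prod_(c in A) f c) * \prod_(c in B) f c.
Proof.
move=> ff; rewrite big_mkcond (big_mkcond (mem A)) (big_mkcond (mem B)) /=.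
rewrite -big_split /=; apply: eq_bigr => c _; rewrite in_symdiff.
by case: (c \in A); case: (c \in B); rewrite ?mulr1 ?mul1r ?ff.
Qed.

Lemma blade_sign_symdiffl A B C :
  blade_sign R (symdiff A B) C = blade_sign R A C * blade_sign R B C.
Proof.
rewrite !blade_signE prod_symdiff // => c; rewrite -big_split big1 //= => b _.
exact: pair_sign_sqr.
Qed.

Lemma blade_sign_symdiffr A B C :
  blade_sign R A (symdiff B C) = blade_sign R A B * blade_sign R A C.
Proof.
rewrite !blade_signE -big_split /=; apply: eq_bigr => a _.
by rewrite prod_symdiff // => b; exact: pair_sign_sqr.
Qed.

Lemma blade_sign0l A : blade_sign R finset.set0 A = 1.
Proof. by rewrite blade_signE big_set0. Qed.

Lemma blade_sign0r A : blade_sign R A finset.set0 = 1.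
Proof. by rewrite blade_signE big1 // => a _; rewrite big_set0. Qed.

Lemma blade_sign_sqr A B : blade_sign R A B * blade_sign R A B = 1.
Proof.
rewrite !blade_signE -big_split big1 //= => a _; rewrite -big_split big1 //= => b _.
exact: pair_sign_sqr.
Qed.

Lemma blade_sign_neq0 A B : blade_sign R A B != 0.
Proof.
by apply: contra_eq_neq (blade_sign_sqr A B) => ->; rewrite mul0r eq_sym oner_neq0.
Qed.

Lemma pair_signC a b : pair_sign a b = (-1) ^+ (a != b) * pair_sign b a.
Proof.
rewrite /pair_sign; case: (ltngtP a b) => [ab|ab|/val_inj ->].
- have /negbTE -> : a != b by apply: contraTneq ab => ->; rewrite ltnn.
  by rewrite expr1 mulrNN mulr1.
- have ne : a != b by apply: contraTneq ab => ->; rewrite ltnn.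
  by rewrite (eq_sym b) (negbTE ne) expr1 mulr1.
- by rewrite eqxx expr0 mul1r.
Qed.

(** Each pair of distinct indices costs a sign. There are #|A| * #|B| - #|A :&: B| such pairs; the
    sum in the exponent has the same parity and avoids truncated subtraction. *)
Lemma blade_signC A B :
  blade_sign R A B = (-1) ^+ (#|A| * #|B| + #|A :&: B|) * blade_sign R B A.
Proof.
rewrite !blade_signE [in RHS]exchange_big /=.
under eq_bigr do under eq_bigr do rewrite pair_signC.
under eq_bigr do rewrite big_split /=.
rewrite big_split /=; congr (_ * _).
(* For fixed a the sign is (-1)^#|B|, corrected once if a itself lies in B. *)
have E a : a \in A ->
    \prod_(b in B) ((-1 : CC) ^+ (a != b)) = (-1) ^+ #|B| * (-1) ^+ (a \in B).
  move=> _; rewrite -prodr_const.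
  have -> : (-1 : CC) ^+ (a \in B) = \prod_(b in B) (-1) ^+ (a == b).
    case: (boolP (a \in B)) => aB; last first.
      rewrite big1 // => b bB; case: eqP => // ab; by rewrite ab bB in aB.
    rewrite (bigD1 a) //= eqxx big1 ?mulr1 // => b /andP[_ /negbTE].
    by rewrite eq_sym => ->.
  rewrite -big_split /=; apply: eq_bigr => b _.
  by case: (a == b); rewrite ?expr0 ?expr1 ?mulrNN ?mulr1.
rewrite (eq_bigr _ E) exprD.
rewrite big_split /= !prodr_const -exprM mulnC; congr (_ * _).
rewrite -prodr_const [RHS](eq_bigl (fun a => (a \in A) && (a \in B))).
  by rewrite big_mkcondr /=; apply: eq_bigr => a _; case: (a \in B).
by move=> a; rewrite inE.
Qed.

Lemma clmulE U V C :
  clmul U V C = \sum_A blade_sign R A (symdiff A C) * (U A * V (symdiff A C)).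
Proof.
rewrite ffunE; apply: eq_bigr => A _.
by under eq_bigl do rewrite symdiff_eq; rewrite big_pred1_eq.
Qed.

Lemma clD U V A : (U + V) A = U A + V A. Proof. by rewrite ffunE. Qed.
Lemma clN U A : (- U) A = - U A. Proof. by rewrite ffunE. Qed.
Lemma cl0 A : (0 : cl) A = 0. Proof. by rewrite ffunE. Qed.

Lemma clmulDl U V W : clmul (U + V) W = clmul U W + clmul V W.
Proof.
apply/ffunP => C; rewrite clD !clmulE -big_split; apply: eq_bigr => A _ /=.
rewrite clD; ring.
Qed.

Lemma clmulDr U V W : clmul U (V + W) = clmul U V + clmul U W.
Proof.
apply/ffunP => C; rewrite clD !clmulE -big_split; apply: eq_bigr => A _ /=.
rewrite clD; ring.
Qed.

Lemma clmulNl U V : clmul (- U) V = - clmul U V.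
Proof.
apply/ffunP => C; rewrite clN !clmulE -sumrN; apply: eq_bigr => A _ /=.
rewrite clN; ring.
Qed.

Lemma clmulNr U V : clmul U (- V) = - clmul U V.
Proof.
apply/ffunP => C; rewrite clN !clmulE -sumrN; apply: eq_bigr => A _ /=.
rewrite clN; ring.
Qed.

Lemma clmulA U V W : clmul U (clmul V W) = clmul (clmul U V) W.
Proof.
apply/ffunP => D; rewrite !clmulE.
under eq_bigr do rewrite clmulE !mulr_sumr.
under [RHS]eq_bigr do rewrite clmulE mulr_suml mulr_sumr.
rewrite [RHS]exchange_big; apply: eq_bigr => A _ /=.
(* The index of the product of U and V becomes [symdiff A B], so that V is evaluated at B on both
   sides. *)
rewrite [RHS](reindex_inj (can_inj (symdiffK A))) /=; apply: eq_bigr => B _.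
rewrite symdiffK (symdiffC A B) -symdiffA.
(* With X the index of W, bimultiplicativity reduces both sides to the signs of the pairs (A, B),
   (A, X) and (B, X). *)
rewrite -{1}(symdiffK B (symdiff A D)); set X := symdiff B (symdiff A D).
rewrite blade_sign_symdiffr blade_sign_symdiffl; ring.
Qed.

Lemma clmul1l U : clmul one U = U.
Proof.
apply/ffunP => C; rewrite clmulE (bigD1 finset.set0) //= big1 => [|A /negbTE A0].
  by rewrite ffunE eqxx blade_sign0l symdiffC symdiff0 !mul1r addr0.
by rewrite ffunE A0 mul0r mulr0.
Qed.

Lemma clmul1r U : clmul U one = U.
Proof.
apply/ffunP => C; rewrite clmulE (bigD1 C) //= big1 => [|A AC].
  have -> : symdiff C C = finset.set0 by apply/eqP; rewrite symdiff_eq symdiff0.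
  by rewrite ffunE eqxx blade_sign0r mul1r mulr1 addr0.
rewrite ffunE; case: eqP => [E|_]; last by rewrite !mulr0.
by move/eqP: E; rewrite symdiff_eq symdiff0 eq_sym (negbTE AC).
Qed.

(** The coefficient of e pairs each blade with itself only, and the sign of (A, A) is the same in
    both orders. *)
Lemma clTr_mulC U V : clTr (clmul U V) = clTr (clmul V U).
Proof.
by rewrite /clTr !clmulE; apply: eq_bigr => A _; rewrite symdiff0 [V A * _]mulrC.
Qed.

(* For odd n one of #|A|, #|~: A| is even, so complementary blades commute. *)
Lemma cl_top_mulC U V : odd (p + q) ->
  clmul U V (finset.setTfor I) = clmul V U (finset.setTfor I).
Proof.
move=> n_odd; have symT A : symdiff A (finset.setTfor I) = ~: A.
  by apply/setP => c; rewrite in_symdiff !inE addbT.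
rewrite !clmulE [RHS](reindex_inj (inv_inj (@finset.setCK I))) /=.
apply: eq_bigr => A _; rewrite !symT finset.setCK (mulrC (U A)) blade_signC.
rewrite finset.setICr cards0 addn0 -signr_odd oddM.
have : odd (#|A| + #|~: A|) by rewrite cardsC card_ord.
by rewrite oddD; case: (odd #|A|); case: (odd #|_|) => //= _; rewrite mul1r.
Qed.

Lemma clZ (z : CC) U A : (z *: U) A = z * U A. Proof. by rewrite ffunE. Qed.

Lemma clmulZl (z : CC) U V : clmul (z *: U) V = z *: clmul U V.
Proof.
apply/ffunP => C; rewrite clZ !clmulE mulr_sumr; apply: eq_bigr => A _ /=.
rewrite clZ; ring.
Qed.

Lemma clmulZr (z : CC) U V : clmul U (z *: V) = z *: clmul U V.
Proof.
apply/ffunP => C; rewrite clZ !clmulE mulr_sumr; apply: eq_bigr => A _ /=.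
rewrite clZ; ring.
Qed.

Lemma clmul0l U : clmul 0 U = 0.
Proof. by rewrite -{1}(scale0r (0 : cl)) clmulZl scale0r. Qed.

Lemma clmul0r U : clmul U 0 = 0.
Proof. by rewrite -{1}(scale0r (0 : cl)) clmulZr scale0r. Qed.

Lemma clmul_suml (J : finType) (f : J -> cl) U :
  clmul (\sum_j f j) U = \sum_j clmul (f j) U.
Proof.
by apply: (big_morph (fun V => clmul V U)) => [V W|]; [exact: clmulDl|exact: clmul0l].
Qed.

Lemma clmul_sumr (J : finType) (f : J -> cl) U :
  clmul U (\sum_j f j) = \sum_j clmul U (f j).
Proof.
by apply: (big_morph (clmul U)) => [V W|]; [exact: clmulDr|exact: clmul0r].
Qed.

Definition blade B : cl := [ffun A => (A == B)%:R].

Lemma clmul_bladel B U A :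
  clmul (blade B) U (symdiff B A) = blade_sign R B A * U A.
Proof.
rewrite clmulE (bigD1 B) //= symdiffK big1 => [|D /negbTE DB].
  by rewrite ffunE eqxx mul1r addr0.
by rewrite ffunE DB mul0r mulr0.
Qed.

Lemma clmul_blader B U A :
  clmul U (blade B) (symdiff A B) = blade_sign R A B * U A.
Proof.
rewrite clmulE (bigD1 A) //= symdiffK big1 => [|D DA].
  by rewrite ffunE eqxx mulr1 addr0.
rewrite ffunE; case: eqP => [E|_]; last by rewrite !mulr0.
case/eqP: DA; apply/setP => c; move/setP/(_ c): E; rewrite !in_symdiff.
by case: (c \in A); case: (c \in B); case: (c \in D).
Qed.

(** Commuting with e^a kills the coefficients at the blades A that anticommute with e^a, namely
    those with #|A| + (a \in A) odd. Such an a exists unless A is empty, or A is full and n is odd;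
    these are the central blades, which [in_clS] excludes. *)
Lemma central_clS0 U : in_clS U ->
  (forall a, clmul U (blade (finset.set1 a)) = clmul (blade (finset.set1 a)) U) ->
  U = 0.
Proof.
move=> [U0 UT] Ucomm; apply/ffunP => A; rewrite cl0.
have key a : odd (#|A| + (a \in A)) -> U A = 0.
  move=> odd_a; have := congr1 (fun V : cl => V (symdiff A (finset.set1 a))) (Ucomm a).
  rewrite clmul_blader symdiffC clmul_bladel blade_signC cards1 muln1.
  have -> : #|A :&: finset.set1 a| = (a \in A).
    case: (boolP (a \in A)) => aA.
      by rewrite (finset.setIidPr _) ?cards1 // finset.sub1set.
    apply: eq_card0 => b; rewrite !inE.
    by case: eqP => [->|]; rewrite ?andbF // andbT (negbTE aA).
  rewrite -signr_odd odd_a expr1 => /eqP; rewrite -subr_eq0 mulN1r mulNr -opprD oppr_eq0.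
  rewrite -mulr2n mulrn_eq0 /= mulf_eq0 (negbTE (blade_sign_neq0 _ _)) /=.
  by move/eqP.
case: (set_0Vmem A) => [-> //|[a aA]].
case: (boolP (odd #|A|)) => [A_odd|A_even]; last first.
  by apply: (key a); rewrite aA addn1 /= A_even.
case: (pickP [pred b | b \notin A]) => [b /= bA|AT].
  by apply: (key b); rewrite (negbTE bA) addn0.
have AE : A = finset.setTfor I.
  by apply/setP => b; rewrite inE; have /negbFE := AT b.
by rewrite AE; apply: UT; move: A_odd; rewrite AE cardsT card_ord.
Qed.

(** * Products of arbitrary Clifford generators form a basis *)

Section Generators.
Variable h : I -> cl.
Hypothesis clifford_h : forall a b, clmul (h a) (h b) + clmul (h b) (h a)
  = [ffun A => if A == @finset.set0 I then 2 * Defs.eta R a b else 0].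

(** Arbitrary index sequences are allowed so that words can be concatenated, permuted and reversed;
    [word (enum I)] is [clprod h]. *)
Definition word w : cl := foldr (@clmul R p q) one [seq h i | i <- w].

Lemma gen_anticomm a b : a != b -> clmul (h a) (h b) = - clmul (h b) (h a).
Proof.
move=> /negbTE ab; apply/eqP; rewrite -subr_eq0 opprK clifford_h /Defs.eta ab.
by apply/eqP/ffunP => A; rewrite cl0 ffunE mulr0 if_same.
Qed.

(** Halving the relation for a = b leaves [eta a a]. The exponent stays existential because later
    only the invertibility of the sign matters. *)
Lemma gen_sqr a : exists e : nat, clmul (h a) (h a) = (-1) ^+ e *: one.
Proof.
exists (~~ (a < p)%N : nat); apply/ffunP => A.
have := congr1 (fun V : cl => V A) (clifford_h a a).
rewrite clD clZ !ffunE /Defs.eta eqxx => E.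
have two0 : (2 : CC) != 0 by rewrite pnatr_eq0.
apply: (mulfI two0); rewrite mulr_natl mulr2n E.
by case: (A == _); case: (a < p)%N; rewrite ?expr0 ?expr1 ?mulr1 ?mulr0 ?mul1r.
Qed.

Lemma word_cat s t : word (s ++ t) = clmul (word s) (word t).
Proof.
by elim: s => [|a s IHs] /=; rewrite /word /= ?clmul1l // -clmulA -IHs.
Qed.

(** Each letter other than a costs a sign; the number of these has the parity of size plus
    multiplicity. *)
Lemma gen_word_comm a w :
  clmul (h a) (word w) = (-1) ^+ (size w + count_mem a w) *: clmul (word w) (h a).
Proof.
elim: w => [|b w IHw]; first by rewrite /word /= expr0 scale1r clmul1l clmul1r.
rewrite -[word (b :: w)]/(clmul (h b) (word w)) clmulA.
have -> : clmul (h a) (h b) = (-1) ^+ (b != a) *: clmul (h b) (h a).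
  case: (eqVneq b a) => [->|ba]; first by rewrite expr0 scale1r.
  by rewrite expr1 scaleN1r gen_anticomm // eq_sym.
rewrite clmulZl -clmulA IHw clmulZr scalerA -exprD clmulA; congr (_ *: _).
rewrite -[LHS]signr_odd -[RHS]signr_odd; congr (_ ^+ (nat_of_bool _)).
by rewrite /=; case: (b == a) => /=; rewrite ?(add0n, add1n, addSn, addnS) /= ?negbK.
Qed.

(** By induction on s: its first letter is moved past the prefix t1 of t that precedes it there, at
    the cost of a sign. *)
Lemma word_perm s t : perm_eq s t -> exists e : nat, word s = (-1) ^+ e *: word t.
Proof.
elim: s t => [|a s IHs] t st.
  by exists 0; rewrite scale1r; move: st; rewrite perm_sym => /perm_nilP ->.
have at_ : a \in t by rewrite -(perm_mem st) mem_head.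
move: st; case/splitPr: at_ => t1 t2 st.
have {}st : perm_eq s (t1 ++ t2).
  rewrite -(perm_cons a); apply: (perm_trans st).
  by rewrite (perm_catCA t1 [:: a] t2).
have [e He] := IHs _ st; exists (e + (size t1 + count_mem a t1))%N.
rewrite -[word (a :: s)]/(clmul (h a) (word s)) He clmulZr exprD -scalerA.
congr (_ *: _); rewrite !word_cat clmulA gen_word_comm clmulZl.
by rewrite -clmulA.
Qed.

(** The product collapses from the middle outwards, one squared generator at a time. *)
Lemma word_rev s : exists e : nat, clmul (word s) (word (rev s)) = (-1) ^+ e *: one.
Proof.
elim: s => [|a s [e He]]; first by exists 0; rewrite scale1r /word /= clmul1l.
have [f Hf] := gen_sqr a; exists (e + f)%N.
rewrite rev_cons -cats1 word_cat -[word (a :: s)]/(clmul (h a) (word s)).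
rewrite -clmulA [clmul (word s) _]clmulA He clmulZl clmul1l clmulZr.
by rewrite /word /= clmul1r Hf scalerA exprD.
Qed.

Lemma word_sqr s : exists e : nat, clmul (word s) (word s) = (-1) ^+ e *: one.
Proof.
have [e He] := word_rev s.
have [f Hf] : exists f : nat, word (s ++ s) = (-1) ^+ f *: word (s ++ rev s).
  by apply: word_perm; rewrite perm_cat2l perm_sym perm_rev.
by exists (f + e)%N; rewrite -word_cat Hf word_cat He scalerA exprD.
Qed.

Lemma clTrZ (z : CC) U : clTr (z *: U) = z * clTr U.
Proof. exact: clZ. Qed.

(** Here [h a] anticommutes with the word, so cyclicity makes the trace of h a * h a * word w its
    own negative, while h a * h a is an invertible scalar. *)
Lemma clTr_word0 a w : odd (size w + count_mem a w) -> clTr (word w) = 0.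
Proof.
move=> odd_a; have [e He] := gen_sqr a.
have E : clTr (clmul (h a) (clmul (h a) (word w))) = 0.
  have : clTr (clmul (h a) (clmul (h a) (word w)))
       = - clTr (clmul (h a) (clmul (h a) (word w))).
    rewrite [LHS]clTr_mulC -clmulA.
    rewrite [in RHS]gen_word_comm -signr_odd odd_a expr1 clmulZr clTrZ mulN1r.
    by rewrite opprK.
  move/eqP; rewrite -subr_eq0 opprK -mulr2n mulrn_eq0 /=; exact: eqP.
move: E; rewrite clmulA He clmulZl clmul1l clTrZ => /eqP.
by rewrite mulf_eq0 signr_eq0 /= => /eqP.
Qed.

Lemma count_mem_enum a A : count_mem a (enum A) = (a \in A).
Proof. by rewrite count_uniq_mem ?enum_uniq // mem_enum. Qed.

Hypothesis clTr_h : clTr (clprod h) = 0.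

(* The trace of a word vanishes as soon as a generator anticommutes with it.
   For A <> B this fails only when B = ~: A and n is odd, where the word is
   the full product up to sign. *)
Lemma clTr_word_pair A B : A != B ->
  clTr (clmul (word (enum A)) (word (enum B))) = 0.
Proof.
move=> AB; rewrite -word_cat.
set w := enum A ++ enum B.
have szw : size w = (#|A| + #|B|)%N by rewrite size_cat -!cardE.
have cntw a : count_mem a w = ((a \in A) + (a \in B))%N.
  by rewrite count_cat !count_mem_enum.
case: (pickP [pred a | odd (size w + count_mem a w)]) => [a|noodd].
  exact: clTr_word0.
have {}noodd a : odd (#|A| + #|B|) = (a \in A) (+) (a \in B).
  have /= := noodd a; rewrite szw cntw !oddD !oddb.
  by case: (odd #|A|); case: (odd #|B|); case: (a \in A); case: (a \in B).
case: (boolP (odd (#|A| + #|B|))) => [AB_odd|AB_even]; last first.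
  case/eqP: AB; apply/setP => a; have := noodd a; rewrite (negbTE AB_even).
  by case: (a \in A); case: (a \in B).
have wperm : perm_eq w (enum I).
  apply: uniq_perm; rewrite ?enum_uniq //.
    rewrite cat_uniq !enum_uniq andbT /=; apply/hasPn => a; rewrite !mem_enum.
    by have := noodd a; rewrite AB_odd; case: (a \in A); case: (a \in B).
  move=> a; rewrite mem_cat !mem_enum.
  by have := noodd a; rewrite AB_odd; case: (a \in A); case: (a \in B).
by have [e ->] := word_perm wperm; rewrite clTrZ clTr_h mulr0.
Qed.

(** Trace orthogonality yields an explicit right inverse K of the matrix M of word coefficients. As
    M is square, K is also a left inverse, and the rows of K *m M = 1 expand blades in words. *)
Lemma blade_span C : exists k : {set I} -> CC,
  blade C = \sum_A k A *: word (enum A).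
Proof.
pose g A := clTr (clmul (word (enum A)) (word (enum A))).
have g0 A : g A != 0.
  rewrite /g; have [e ->] := word_sqr (enum A); rewrite clTrZ.
  by rewrite mulf_neq0 ?signr_eq0 // /clTr ffunE eqxx oner_neq0.
pose N := #|{set I}|; pose ev (i : 'I_N) : {set I} := enum_val i.
pose M : 'M[CC]_N := \matrix_(i, j) word (enum (ev i)) (ev j).
(* In blade coordinates Tr (U V) is the sum over A of [blade_sign A A] * U A * V A; K holds these
   signed coordinates, normalized by the diagonal values g. *)
pose K : 'M[CC]_N := \matrix_(i, j)
  (blade_sign R (ev i) (ev i) * word (enum (ev j)) (ev i) / g (ev j)).
have sum_ev (f : {set I} -> CC) : \sum_A f A = \sum_i f (ev i).
  rewrite (reindex_onto ev enum_rank) /= => [|A _]; last exact: enum_rankK.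
  by apply: eq_bigl => i; rewrite enum_valK eqxx.
have MK : M *m K = 1%:M.
  apply/matrixP => i j; rewrite !mxE.
  have -> : \sum_k M i k * K k j =
      clTr (clmul (word (enum (ev i))) (word (enum (ev j)))) / g (ev j).
    rewrite /clTr clmulE mulr_suml sum_ev; apply: eq_bigr => k _.
    by rewrite !mxE symdiff0; ring.
  case: (eqVneq i j) => [<-|ij]; first by rewrite divff ?g0.
  by rewrite clTr_word_pair ?mul0r // (inj_eq enum_val_inj).
have KM := mulmx1C MK.
exists (fun A => K (enum_rank C) (enum_rank A)); apply/ffunP => D.
have /matrixP/(_ (enum_rank C) (enum_rank D)) := KM.
rewrite !mxE (inj_eq enum_rank_inj) ffunE eq_sym => <-.
rewrite sum_ffunE sum_ev; apply: eq_bigr => k _.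
by rewrite clZ enum_valK [M _ _]mxE /ev enum_rankK.
Qed.

(** Commuting with the [h a] passes to all words, hence to the blades e^a that they span, and
    [central_clS0] applies. *)
Lemma clifford_commutant U : in_clS U ->
  (forall a, clmul U (h a) = clmul (h a) U) -> U = 0.
Proof.
move=> US Uh; apply: central_clS0 US _ => a.
have Uw w : clmul U (word w) = clmul (word w) U.
  elim: w => [|b w IHw]; first by rewrite /word /= clmul1l clmul1r.
  rewrite -[word (b :: w)]/(clmul (h b) (word w)) clmulA Uh.
  by rewrite -clmulA IHw clmulA.
have [k ->] := blade_span (finset.set1 a).
rewrite clmul_suml clmul_sumr; apply: eq_bigr => A _.
by rewrite clmulZl clmulZr Uw.
Qed.

End Generators.
End CliffordAlgebra.

(** * Symmetry of second directional derivatives *)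

Section Schwarz.
Local Open Scope classical_set_scope.
Variables (R : realType) (V : normedModType R).
Implicit Types (f : V -> R) (x y u v : V).

Lemma is_derive_line f y v (t : R) : (forall z, derivable f z v) ->
  is_derive t 1 (fun s : R => f (s *: v + y)) ('D_v f (t *: v + y)).
Proof.
move=> df.
have E : (fun h : R => h^-1 *: (((fun s : R => f (s *: v + y)) \o shift t) (h *: 1)
            - f (t *: v + y)))
       = (fun h : R => h^-1 *: ((f \o shift (t *: v + y)) (h *: v)
            - f (t *: v + y))).
  apply/funext => h /=; congr (_ *: (f _ - _)).
  by rewrite /shift /= scalerDl addrA [h *: 1]mulr1.
by split; rewrite /derivable /derive E //; exact: df.
Qed.

Lemma line_MVT f y v (t : R) : 0 < t -> (forall z, derivable f z v) ->
  exists2 c, 0 < c < t & f (t *: v + y) - f y = 'D_v f (c *: v + y) * t.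
Proof.
move=> t0 df.
have dl s := is_derive_line y s df.
have [|c] := @MVT R _ (fun s : R => 'D_v f (s *: v + y)) 0 t t0 (fun s _ => dl s).
  apply: continuous_subspaceT => s; apply: differentiable_continuous.
  by apply/derivable1_diffP; have [] := dl s.
rewrite in_itv /= scale0r add0r subr0 => c0t E.
by exists c.
Qed.

(** The mean value theorem is used twice: along u for g z = f (z + t v) - f z, then along v for the
    derivative of f along u. *)
Lemma second_difference f x u v (t : R) : 0 < t ->
  (forall z, derivable f z u) -> (forall z, derivable ('D_u f) z v) ->
  exists c d : R, [/\ 0 < c < t, 0 < d < t &
    f (t *: u + (t *: v + x)) - f (t *: u + x) - (f (t *: v + x) - f x)
    = 'D_v ('D_u f) (d *: v + (c *: u + x)) * t * t].
Proof.
move=> t0 df ddf.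
pose g z := f (z + t *: v) - f z.
have dg z : is_derive z u g ('D_u f (z + t *: v) - 'D_u f z).
  have dshift : is_derive z u (fun y => f (y + t *: v)) ('D_u f (z + t *: v)).
    have E : (fun h : R => h^-1 *: (((fun y => f (y + t *: v)) \o shift z) (h *: u)
                - f (z + t *: v)))
           = (fun h : R => h^-1 *: ((f \o shift (z + t *: v)) (h *: u)
                - f (z + t *: v))).
      by apply/funext => h /=; rewrite /shift /= addrA.
    by split; rewrite /derivable /derive E //; exact: df.
  by apply: is_deriveB => //; exact/derivableP/df.
have [|c c0t Ec] := @line_MVT g x u t t0.
  by move=> z; have [] := dg z.
have [d d0t Ed] := @line_MVT ('D_u f) (c *: u + x) v t t0 ddf.
exists c, d; split=> //.
have -> : 'D_v ('D_u f) (d *: v + (c *: u + x)) * t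
   = 'D_u g (c *: u + x).
  by rewrite -Ed [RHS](@derive_val _ _ _ _ _ _ _ (dg _)) (addrC (t *: v)).
rewrite -Ec /g; congr (f _ - _ - (f _ - _)).
  by rewrite -addrA (addrC x).
by rewrite addrC.
Qed.

Lemma near_box f x u v (e : R) : {for x, continuous f} -> 0 < e ->
  exists2 t : R, 0 < t & forall c d s : R, 0 < s <= t -> 0 < c < s -> 0 < d < s ->
    `|f x - f (d *: v + (c *: u + x))| < e.
Proof.
move=> fx e0; have /cvgrPdist_lt /(_ e e0) /nbhs_ballP[r /= r0 rP] := fx.
have uv0 : 0 < `|u| + `|v| + 1 by rewrite ltr_wpDl // addr_ge0.
(* The summand 1 keeps the denominator positive even when u = v = 0. *)
exists (r / (`|u| + `|v| + 1)); first by rewrite divr_gt0.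
move=> c d s /andP[s0 st] /andP[c0 cs] /andP[d0 ds]; apply: rP.
rewrite -ball_normE /ball_ /= addrA opprD addrCA subrr addr0 normrN addrC.
apply: (le_lt_trans (ler_normD _ _)); rewrite !normrZ (gtr0_norm c0) (gtr0_norm d0).
have : c * `|u| + d * `|v| <= s * (`|u| + `|v|).
  by rewrite mulrDr lerD // ler_wpM2r // ltW.
have : s * (`|u| + `|v| + 1) <= r by rewrite -ler_pdivlMr.
rewrite mulrDr mulr1; lra.
Qed.

(** The common value is taken at possibly different points, each as close to x as desired, so
    continuity brings f x and g x within e / 2 of it. *)
Lemma eq_of_near_values f g x u v :
  {for x, continuous f} -> {for x, continuous g} ->
  (forall t : R, 0 < t -> exists c d c' d' : R,
    [/\ 0 < c < t, 0 < d < t, 0 < c' < t, 0 < d' < t &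
     f (d *: v + (c *: u + x)) = g (d' *: u + (c' *: v + x))]) ->
  f x = g x.
Proof.
move=> cf cg fg; apply/eqP; rewrite -subr_eq0 -normr_le0.
apply/ler_addgt0Pr => e e0; rewrite add0r.
have e20 : 0 < e / 2 by rewrite divr_gt0.
have [t1 t10 near1] := near_box u v cf e20.
have [t2 t20 near2] := near_box v u cg e20.
pose t := Num.min t1 t2.
have t0 : 0 < t by rewrite lt_min t10.
have [c [d [c' [d' [ct dt ct' dt' E]]]]] := fg t t0.
have n1 := near1 c d t; have n2 := near2 c' d' t.
rewrite t0 /= ge_min lexx in n1; rewrite t0 /= ge_min lexx orbT in n2.
move: (n1 isT ct dt) (n2 isT ct' dt'); rewrite E; move: (g (_ + _)) => z lt1 lt2.
have -> : f x - g x = (f x - z) - (g x - z) by ring.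
apply: (le_trans (ler_normB _ _)); lra.
Qed.

(** The second difference over the parallelogram spanned by t u and t v is symmetric in u and v.
    Dividing by t * t gives equal values of the two mixed derivatives at points near x. *)
Lemma derive_comm f x u v :
  (forall z, derivable f z u) -> (forall z, derivable f z v) ->
  (forall z, derivable ('D_u f) z v) -> (forall z, derivable ('D_v f) z u) ->
  {for x, continuous ('D_v ('D_u f))} -> {for x, continuous ('D_u ('D_v f))} ->
  'D_v ('D_u f) x = 'D_u ('D_v f) x.
Proof.
move=> du dv duv dvu cuv cvu; apply: (eq_of_near_values (u := u) (v := v) cuv cvu).
move=> t t0.
have [c [d [ct dt E1]]] := second_difference x t0 du duv.
have [c' [d' [ct' dt' E2]]] := second_difference x t0 dv dvu.
exists c, d, c', d'; split; [exact: ct|exact: dt|exact: ct'|exact: dt'|].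
apply: (mulIf (lt0r_neq0 t0)); apply: (mulIf (lt0r_neq0 t0)).
apply: etrans (esym E1) _; apply: etrans _ E2.
have sub4 (a b k l : R) : a - b - (k - l) = a - k - (b - l) by ring.
have swap : t *: v + (t *: u + x) = t *: u + (t *: v + x) by rewrite addrCA.
by rewrite swap; exact: sub4.
Qed.

End Schwarz.

(** * A submultiplicative norm on the Clifford algebra *)

Section CliffordCalculus.
Local Open Scope classical_set_scope.
Local Open Scope complex_scope.
Variables (R : realType) (p q : nat).
Local Notation CC := (complex.complex R).
Local Notation I := 'I_(p + q).
Local Notation cl := (cl R p q).
Local Notation X := (Rpq R p q).
Local Notation one := (clunit R p q).
Implicit Types (A B C : {set I}) (U V W : cl) (z w : CC) (mu nu : I) (x : X).

Local Notation Re := complex.Re.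
Local Notation Im := complex.Im.

Lemma ReD z w : Re (z + w) = Re z + Re w. Proof. by case: z; case: w. Qed.
Lemma ImD z w : Im (z + w) = Im z + Im w. Proof. by case: z; case: w. Qed.
Lemma ReN z : Re (- z) = - Re z. Proof. by case: z. Qed.
Lemma ImN z : Im (- z) = - Im z. Proof. by case: z. Qed.
Lemma ReM z w : Re (z * w) = Re z * Re w - Im z * Im w.
Proof. by case: z; case: w. Qed.
Lemma ImM z w : Im (z * w) = Re z * Im w + Im z * Re w.
Proof. by case: z; case: w. Qed.

(** This sum norm is real-valued, submultiplicative, and dominates both parts directly. *)
Definition cabs z : R := `|Re z| + `|Im z|.

Lemma cabs_ge0 z : 0 <= cabs z. Proof. by rewrite addr_ge0. Qed.

Lemma cabs0 : cabs 0 = 0. Proof. by rewrite /cabs normr0 addr0. Qed.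

Lemma cabsD z w : cabs (z + w) <= cabs z + cabs w.
Proof. by rewrite /cabs ReD ImD addrACA lerD // ler_normD. Qed.

Lemma cabsN z : cabs (- z) = cabs z.
Proof. by rewrite /cabs ReN ImN !normrN. Qed.

Lemma cabsM z w : cabs (z * w) <= cabs z * cabs w.
Proof.
rewrite /cabs ReM ImM.
have := ler_normB (Re z * Re w) (Im z * Im w).
have := ler_normD (Re z * Im w) (Im z * Re w).
rewrite !normrM; lra.
Qed.

Lemma cabs_sum (J : Type) (r : seq J) (f : J -> CC) :
  cabs (\sum_(j <- r) f j) <= \sum_(j <- r) cabs (f j).
Proof.
elim/big_ind2: _ => [|z s w t zs wt|//]; first by rewrite cabs0.
by apply: le_trans (cabsD _ _) (lerD zs wt).
Qed.

Lemma cabs_blade_sign A B z : cabs (blade_sign R A B * z) = cabs z.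
Proof.
have /eqP := blade_sign_sqr R A B.
rewrite -expr2 sqrf_eq1 => /orP[] /eqP ->; first by rewrite mul1r.
by rewrite mulN1r cabsN.
Qed.

Definition clnorm U : R := \sum_A cabs (U A).

Lemma clnorm_ge0 U : 0 <= clnorm U.
Proof. by apply: sumr_ge0 => A _; exact: cabs_ge0. Qed.

Lemma clnorm0 : clnorm 0 = 0.
Proof. by rewrite /clnorm big1 // => A _; rewrite cl0 cabs0. Qed.

Lemma clnormD U V : clnorm (U + V) <= clnorm U + clnorm V.
Proof. by rewrite /clnorm -big_split; apply: ler_sum => A _; rewrite clD cabsD. Qed.

Lemma clnormN U : clnorm (- U) = clnorm U.
Proof. by apply: eq_bigr => A _; rewrite clN cabsN. Qed.

(** The product of the norms is regrouped by the index [symdiff A B] of the resulting blade; blade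
    signs do not change [cabs]. *)
Lemma clnormM U V : clnorm (clmul U V) <= clnorm U * clnorm V.
Proof.
have -> : clnorm U * clnorm V
    = \sum_C \sum_A cabs (U A) * cabs (V (symdiff A C)).
  rewrite exchange_big mulr_suml; apply: eq_bigr => A _ /=.
  rewrite -mulr_sumr; congr (_ * _).
  by rewrite /clnorm [LHS](reindex_inj (can_inj (symdiffK A))).
apply: ler_sum => C _; rewrite clmulE.
apply: (le_trans (cabs_sum _ _)); apply: ler_sum => A _.
by rewrite cabs_blade_sign cabsM.
Qed.

Lemma clnormZ (r : R) U : clnorm (r%:C *: U) = `|r| * clnorm U.
Proof.
rewrite /clnorm mulr_sumr; apply: eq_bigr => A _.
by rewrite clZ /cabs ReM ImM /= !mul0r subr0 addr0 !normrM -mulrDr.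
Qed.

Lemma cabs_le_clnorm U A : cabs (U A) <= clnorm U.
Proof.
rewrite /clnorm (bigD1 A) //= lerDl; apply: sumr_ge0 => B _; exact: cabs_ge0.
Qed.

(** * Limits of Clifford-valued functions *)

Section Limits.
Variables (T : Type) (F : set_system T).
Context {FF : Filter F}.
Implicit Types (f g : T -> cl) (k l : cl).

Lemma cvgD0 (u v : T -> R) : u t @[t --> F] --> (0 : R) ->
  v t @[t --> F] --> (0 : R) -> u t + v t @[t --> F] --> (0 : R).
Proof. by move=> u0 v0; rewrite -(addr0 (0 : R)); exact: cvgD. Qed.

Lemma cvgM0 (u v : T -> R) : u t @[t --> F] --> (0 : R) ->
  v t @[t --> F] --> (0 : R) -> u t * v t @[t --> F] --> (0 : R).
Proof. by move=> u0 v0; rewrite -(mulr0 (0 : R)); exact: cvgM. Qed.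

Lemma cvgZ0 (r : R) (u : T -> R) : u t @[t --> F] --> (0 : R) ->
  r * u t @[t --> F] --> (0 : R).
Proof. by move=> u0; rewrite -(mulr0 r); apply: cvgM u0; exact: cvg_cst. Qed.

(** Convergence is expressed by a real limit, so squeezing in [R] does the work and [cl] needs no
    topology. *)
Definition clcvg f l := clnorm (f t - l) @[t --> F] --> (0 : R).

Lemma clcvg_le f l (u : T -> R) : (\forall t \near F, clnorm (f t - l) <= u t) ->
  u t @[t --> F] --> (0 : R) -> clcvg f l.
Proof.
move=> fu u0; apply: (squeeze_cvgr (f := fun=> 0) (h := u)) => //.
  by near=> t; rewrite clnorm_ge0 /=; near: t.
exact: cvg_cst.
Unshelve. all: by end_near. Qed.

Lemma clcvg_cst l : clcvg (fun=> l) l.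
Proof.
apply: (@clcvg_le _ _ (fun=> 0)); last exact: cvg_cst.
by near=> t; rewrite subrr clnorm0.
Unshelve. all: by end_near. Qed.

Lemma clcvgD f g k l : clcvg f k -> clcvg g l -> clcvg (fun t => f t + g t) (k + l).
Proof.
move=> fk gl.
apply: (@clcvg_le _ _ (fun t => clnorm (f t - k) + clnorm (g t - l))).
  by near=> t; rewrite opprD addrACA clnormD.
exact: cvgD0.
Unshelve. all: by end_near. Qed.

Lemma clcvgN f k : clcvg f k -> clcvg (fun t => - f t) (- k).
Proof.
move=> fk; apply: (@clcvg_le _ _ (fun t => clnorm (f t - k))) => //.
by near=> t; rewrite -opprD clnormN.
Unshelve. all: by end_near. Qed.

Lemma clcvgM f g k l : clcvg f k -> clcvg g l ->
  clcvg (fun t => clmul (f t) (g t)) (clmul k l).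
Proof.
move=> fk gl.
apply: (@clcvg_le _ _ (fun t => clnorm (f t - k) * clnorm (g t - l)
   + (clnorm (f t - k) * clnorm l + clnorm k * clnorm (g t - l)))).
  near=> t.
  (* Expanding around (k, l) leaves only terms with a factor tending to 0. *)
  have -> : clmul (f t) (g t) - clmul k l = clmul (f t - k) (g t - l)
       + (clmul (f t - k) l + clmul k (g t - l)).
    rewrite !(clmulDl, clmulDr, clmulNl, clmulNr).
    by apply/ffunP => A; rewrite !(clD, clN); ring.
  apply: (le_trans (clnormD _ _)); rewrite lerD ?clnormM //.
  by apply: (le_trans (clnormD _ _)); rewrite lerD ?clnormM.
apply: cvgD0; first exact: cvgM0.
by apply: cvgD0; [under eq_fun do rewrite mulrC|]; exact: cvgZ0.
Unshelve. all: by end_near. Qed.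

Lemma cvg_sum0 (J : Type) (r : seq J) (u : J -> T -> R) :
  (forall j, u j t @[t --> F] --> (0 : R)) ->
  \sum_(j <- r) u j t @[t --> F] --> (0 : R).
Proof.
move=> u0; elim: r => [|j r IHr].
  by under eq_fun do rewrite big_nil; exact: cvg_cst.
under eq_fun do rewrite big_cons.
exact: cvgD0.
Qed.

(** This links norm limits with the coefficientwise real limits behind [clpartial]. *)
Lemma clcvgP f l : clcvg f l <-> forall A,
  Re (f t A) @[t --> F] --> Re (l A) /\ Im (f t A) @[t --> F] --> Im (l A).
Proof.
split=> [fl A|fl].
  have le t : `|Re (f t A) - Re (l A)| + `|Im (f t A) - Im (l A)| <= clnorm (f t - l).
    have := cabs_le_clnorm (f t - l) A.
    by rewrite clD clN /cabs ReD ReN ImD ImN.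
  split; apply/subr_cvg0/norm_cvg0P;
    apply: (squeeze_cvgr (f := fun=> 0) (h := fun t => clnorm (f t - l))) => //;
    try exact: cvg_cst; near=> t; rewrite normr_ge0 /=;
    apply: le_trans (le t); by rewrite ?lerDl ?lerDr.
apply: cvg_sum0 => A; have [fRe fIm] := fl A.
have -> : (fun t => cabs ((f t - l) A))
    = (fun t => `|Re (f t A) - Re (l A)| + `|Im (f t A) - Im (l A)|).
  by apply/funext => t; rewrite clD clN /cabs ReD ReN ImD ImN.
apply: cvgD0.
  by apply/norm_cvg0P/subr_cvg0.
by apply/norm_cvg0P/subr_cvg0.
Unshelve. all: by end_near. Qed.

(* The identity g - l = - g (f - k) l bounds g once f is close to k. *)
Lemma clcvg_inv f g k l : (forall t, clmul (g t) (f t) = one) -> clmul k l = one ->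
  clcvg f k -> clcvg g l.
Proof.
move=> gf kl fk; pose d t := clnorm (f t - k).
have E t : g t - l = - clmul (g t) (clmul (f t - k) l).
  rewrite clmulDl clmulNl kl clmulDr clmulNr clmulA gf clmul1l clmul1r.
  by rewrite opprB.
have bound t : clnorm (g t - l) <= clnorm (g t) * (d t * clnorm l).
  rewrite E clnormN; apply: (le_trans (clnormM _ _)).
  by rewrite ler_wpM2l ?clnorm_ge0 // clnormM.
have dl0 : d t * clnorm l @[t --> F] --> (0 : R).
  by under eq_fun do rewrite mulrC; exact: cvgZ0.
(* Once d t * |l| <= 1/2, the bound gives |g| <= |g - l| + |l| <= |g| / 2 + |l|, hence |g| <= 2
   |l|. *)
apply: (@clcvg_le _ _ (fun t => 2 * clnorm l * (d t * clnorm l))); last first.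
  exact: cvgZ0.
near=> t; apply: (le_trans (bound t)).
have small : d t * clnorm l <= 1 / 2.
  have : `|d t * clnorm l| <= 1 / 2.
    near: t; apply: (cvgr_norm_le _ dl0); rewrite normr0; lra.
  by rewrite ger0_norm // mulr_ge0 ?clnorm_ge0.
have dl_ge0 : 0 <= d t * clnorm l by rewrite mulr_ge0 ?clnorm_ge0.
rewrite ler_wpM2r //.
have : clnorm (g t) <= clnorm (g t - l) + clnorm l.
  by rewrite -{1}(subrK l (g t)) clnormD.
have := bound t; have : clnorm (g t) * (d t * clnorm l) <= clnorm (g t) * (1 / 2).
  by rewrite ler_wpM2l ?clnorm_ge0.
lra.
Unshelve. all: by end_near. Qed.

End Limits.

(** * Differentiation rules in the Clifford algebra *)

Implicit Types (f g : X -> cl).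

(** One limit in the algebra replaces the real limits of all coefficients, so the product and
    inverse rules need no coordinates. *)
Definition clderiv mu (f : X -> cl) x (l : cl) :=
  clcvg (0 : R)^' (fun t : R => t^-1%:C *: (f (t *: dir R mu + x) - f x)) l.

Lemma coefRe_quotient mu f x A :
  (fun t : R => Re ((t^-1%:C *: (f (t *: dir R mu + x) - f x)) A))
  = (fun t => t^-1 *: ((coefRe f A \o shift x) (t *: dir R mu) - coefRe f A x)).
Proof.
apply/funext => t; rewrite clZ clD clN ReM ReD ReN /= mul0r subr0.
by rewrite /coefRe /shift.
Qed.

Lemma coefIm_quotient mu f x A :
  (fun t : R => Im ((t^-1%:C *: (f (t *: dir R mu + x) - f x)) A))
  = (fun t => t^-1 *: ((coefIm f A \o shift x) (t *: dir R mu) - coefIm f A x)).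
Proof.
apply/funext => t; rewrite clZ clD clN ImM ImD ImN /= mul0r addr0.
by rewrite /coefIm /shift.
Qed.

Lemma clpartialE mu f x A :
  clpartial mu f x A = rpartial mu (coefRe f A) x +i* rpartial mu (coefIm f A) x.
Proof. by rewrite ffunE. Qed.

Lemma clderiv_partial mu f x l : clderiv mu f x l -> clpartial mu f x = l.
Proof.
move=> /clcvgP fl; apply/ffunP => A; rewrite clpartialE.
have [] := fl A; rewrite coefRe_quotient coefIm_quotient => fRe fIm.
have -> : l A = Re (l A) +i* Im (l A) by case: (l A).
by congr (_ +i* _); apply: cvg_lim => //; exact: Rhausdorff.
Qed.

Lemma clCk_deriv n mu f x : clCk n.+1 f -> clderiv mu f x (clpartial mu f x).
Proof.
move=> fn; apply/clcvgP => A; rewrite coefRe_quotient coefIm_quotient clpartialE /=.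
by have [[_ [dRe _]] [_ [dIm _]]] := fn A; split; [exact: dRe|exact: dIm].
Qed.

(** The increment has norm |t| times that of the quotient, which is at most its distance to l plus
    |l|. *)
Lemma clderiv_cvg mu f x l : clderiv mu f x l ->
  clcvg (0 : R)^' (fun t : R => f (t *: dir R mu + x)) (f x).
Proof.
move=> fl.
have t0 : `|t| @[t --> (0 : R)^'] --> (0 : R).
  by apply/norm_cvg0P; apply: cvg_within_filter; exact: cvg_id.
apply: (@clcvg_le _ _ _ _ _ (fun t : R => `|t| *
   clnorm (t^-1%:C *: (f (t *: dir R mu + x) - f x) - l) + clnorm l * `|t|)).
  near=> t.
  have tn0 : t != 0 by near: t; exact: nbhs_dnbhs_neq.
  have -> : clnorm (f (t *: dir R mu + x) - f x)
      = `|t| * clnorm (t^-1%:C *: (f (t *: dir R mu + x) - f x)).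
    by rewrite -clnormZ scalerA -rmorphM mulfV // scale1r.
  rewrite (mulrC (clnorm l)) -mulrDr ler_wpM2l //.
  by rewrite -{1}(subrK l (t^-1%:C *: _)) clnormD.
apply: cvgD0; last exact: cvgZ0.
exact: cvgM0.
Unshelve. all: by end_near. Qed.

Lemma clderivD mu f g x k l : clderiv mu f x k -> clderiv mu g x l ->
  clderiv mu (fun y => f y + g y) x (k + l).
Proof.
move=> fk gl; rewrite /clderiv.
by under eq_fun do rewrite opprD addrACA scalerDr; exact: clcvgD.
Qed.

Lemma clderivN mu f x k : clderiv mu f x k -> clderiv mu (fun y => - f y) x (- k).
Proof.
move=> fk; rewrite /clderiv.
by under eq_fun do rewrite -opprD scalerN; exact: clcvgN.
Qed.

(** The increment splits as (f(y) - f(x)) g(y) + f(x) (g(y) - g(x)) with the order of factors kept;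
    g(y) tends to g(x) by [clderiv_cvg]. *)
Lemma clderivM mu f g x k l : clderiv mu f x k -> clderiv mu g x l ->
  clderiv mu (fun y => clmul (f y) (g y)) x (clmul k (g x) + clmul (f x) l).
Proof.
move=> fk gl; rewrite /clderiv.
under eq_fun => t.
  have -> : t^-1%:C *: (clmul (f (t *: dir R mu + x)) (g (t *: dir R mu + x))
                        - clmul (f x) (g x))
     = clmul (t^-1%:C *: (f (t *: dir R mu + x) - f x)) (g (t *: dir R mu + x))
       + clmul (f x) (t^-1%:C *: (g (t *: dir R mu + x) - g x)).
    rewrite clmulZl clmulZr -scalerDr; congr (_ *: _).
    rewrite clmulDl clmulDr clmulNl clmulNr; by rewrite addrA subrK.
  over.
apply: clcvgD; apply: clcvgM => //; [exact: clderiv_cvg gl|exact: clcvg_cst].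
Qed.

Lemma clderiv_inv mu f g x k : (forall y, clmul (f y) (g y) = one) ->
  (forall y, clmul (g y) (f y) = one) -> clderiv mu f x k ->
  clderiv mu g x (- clmul (g x) (clmul k (g x))).
Proof.
move=> fg gf fk; rewrite /clderiv.
under eq_fun => t.
  have -> : t^-1%:C *: (g (t *: dir R mu + x) - g x)
     = - clmul (g (t *: dir R mu + x))
          (clmul (t^-1%:C *: (f (t *: dir R mu + x) - f x)) (g x)).
    rewrite clmulZl clmulZr -scalerN; congr (_ *: _).
    rewrite clmulDl clmulNl fg clmulDr clmulNr clmulA gf clmul1l clmul1r.
    by rewrite opprB.
  over.
apply: clcvgN; apply: clcvgM; last by apply: clcvgM => //; exact: clcvg_cst.
by apply: clcvg_inv (clderiv_cvg fk).
Qed.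

Lemma coefRe_partial mu f A : coefRe (clpartial mu f) A = rpartial mu (coefRe f A).
Proof. by apply/funext => y; rewrite /coefRe ffunE. Qed.

Lemma coefIm_partial mu f A : coefIm (clpartial mu f) A = rpartial mu (coefIm f A).
Proof. by apply/funext => y; rewrite /coefIm ffunE. Qed.

Lemma rpartial_comm mu nu x (u : X -> R) : rCk 2 u ->
  rpartial mu (rpartial nu u) x = rpartial nu (rpartial mu u) x.
Proof.
move=> [_ [du d2u]]; have [_ [dmu cmu]] := d2u mu; have [_ [dnu cnu]] := d2u nu.
by apply: derive_comm => //; [exact: cnu|exact: cmu].
Qed.

Lemma clpartial_comm mu nu f x : clCk 2 f ->
  clpartial mu (clpartial nu f) x = clpartial nu (clpartial mu f) x.
Proof.
move=> f2; apply/ffunP => A; have [fRe fIm] := f2 A.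
have eqRe : rpartial mu (coefRe (clpartial nu f) A) x
          = rpartial nu (coefRe (clpartial mu f) A) x.
  by rewrite (coefRe_partial nu) (coefRe_partial mu); exact: rpartial_comm.
have eqIm : rpartial mu (coefIm (clpartial nu f) A) x
          = rpartial nu (coefIm (clpartial mu f) A) x.
  by rewrite (coefIm_partial nu) (coefIm_partial mu); exact: rpartial_comm.
apply: etrans (clpartialE _ _ _ _) _; apply: etrans _ (esym (clpartialE _ _ _ _)).
exact: (f_equal2 (@Complex R) eqRe eqIm).
Qed.

Lemma clCk_partial n mu f : clCk n.+1 f -> clCk n (clpartial mu f).
Proof.
move=> fn A; rewrite coefRe_partial coefIm_partial.
by have [[_ [_ fRe]] [_ [_ fIm]]] := fn A; split; [exact: fRe|exact: fIm].
Qed.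

(** * Vanishing of the curvature and gauge transformations *)

Lemma clpartial_coef0 mu f x A : (forall y, f y A = 0) -> clpartial mu f x A = 0.
Proof.
move=> fA; rewrite clpartialE.
have -> : coefRe f A = cst 0 by apply/funext => y; rewrite /coefRe fA.
have -> : coefIm f A = cst 0 by apply/funext => y; rewrite /coefIm fA.
by rewrite /rpartial derive_cst.
Qed.

Lemma in_clS_partial mu f x : (forall y, in_clS (f y)) -> in_clS (clpartial mu f x).
Proof.
move=> fS; split=> [|n_odd]; apply: clpartial_coef0 => y; have [f0 fT] := fS y => //.
exact: fT.
Qed.

(** The coefficient of e, and for odd n the top one, is symmetric in the two factors of a
    product. *)
Lemma in_clS_comm U V : in_clS (clcomm U V).
Proof.
split=> [|n_odd]; rewrite clD clN; apply/eqP; rewrite subr_eq0; apply/eqP.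
  exact: clTr_mulC.
exact: cl_top_mulC.
Qed.

Lemma in_clSB U V : in_clS U -> in_clS V -> in_clS (U - V).
Proof.
move=> [U0 UT] [V0 VT]; split=> [|n_odd]; rewrite clD clN.
  by rewrite U0 V0 subrr.
by rewrite UT // VT // subrr.
Qed.

Lemma parallel_zero_curvature (h C : I -> X -> cl) :
  clifford_field_vector h -> (forall mu x, in_clS (C mu x)) ->
  (forall mu, clCk 2 (h mu)) -> (forall mu, clCk 2 (C mu)) ->
  (forall mu nu x, clpartial mu (h nu) x - clcomm (C mu x) (h nu x) = 0) ->
  zero_curvature C.
Proof.
move=> hcl CS h2 C2 dh mu nu x.
have {}dh l r : clpartial l (h r) = fun y => clcomm (C l y) (h r y).
  by apply/funext => y; apply/eqP; rewrite -subr_eq0 dh.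
(* The product rule is applied to [C_m, h_r], and d_l h_r is again replaced by [C_l, h_r]. *)
have ddh l m r : clpartial l (clpartial m (h r)) x =
    clmul (clpartial l (C m) x) (h r x) + clmul (C m x) (clcomm (C l x) (h r x))
    - (clmul (clcomm (C l x) (h r x)) (C m x) + clmul (h r x) (clpartial l (C m) x)).
  rewrite (dh m r); apply: clderiv_partial.
  have dC := clCk_deriv l x (C2 m).
  have dhr : clderiv l (h r) x (clcomm (C l x) (h r x)).
    by have := clCk_deriv l x (h2 r); rewrite dh.
  by apply: clderivD; [|apply: clderivN]; apply: clderivM.
have [rel tr] := hcl x.
apply: (clifford_commutant rel tr).
  by apply: in_clSB (in_clS_comm _ _); apply: in_clSB; apply: in_clS_partial => y.
(* By the Jacobi identity, [C_nu, [C_mu, h]] - [C_mu, [C_nu, h]] = - [[C_mu, C_nu], h], so the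
   difference of the mixed derivatives is [K, h]. *)
move=> a; have /eqP := clpartial_comm mu nu x (h2 a).
rewrite !ddh -subr_eq0 => /eqP E; apply/eqP; rewrite -subr_eq0 -E; apply/eqP.
rewrite /clcomm !(clmulDl, clmulDr, clmulNl, clmulNr) -!clmulA.
by apply/ffunP => A; rewrite !(clD, clN); ring.
Qed.

(** The algebraic core of gauge covariance, in noncommuting letters: T stands for S^-1, Sm and Sn
    for the first derivatives of S, Smn for the mixed one, dCn for d_m C_n and dCm for d_n C_m.
    Expansion and cancellation of inner factors S T suffice. *)
Lemma gauge_curvatureE (S T Cm Cn Sm Sn Smn dCn dCm : cl) : clmul S T = one ->
  clmul (clmul (- clmul T (clmul Sm T)) Cn + clmul T dCn) S
    + clmul (clmul T Cn) Sm
    - (clmul (- clmul T (clmul Sm T)) Sn + clmul T Smn)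
  - (clmul (clmul (- clmul T (clmul Sn T)) Cm + clmul T dCm) S
      + clmul (clmul T Cm) Sn
      - (clmul (- clmul T (clmul Sn T)) Sm + clmul T Smn))
  - clcomm (clmul (clmul T Cm) S - clmul T Sm) (clmul (clmul T Cn) S - clmul T Sn)
  = clmul T (clmul (dCn - dCm - clcomm Cm Cn) S).
Proof.
move=> ST; have STU U : clmul S (clmul T U) = U by rewrite clmulA ST clmul1l.
rewrite /clcomm !(clmulDl, clmulDr, clmulNl, clmulNr) -!clmulA !STU.
by apply/ffunP => A; rewrite !(clD, clN); ring.
Qed.

Lemma gauge_zero_curvature (C : I -> X -> cl) (S T : X -> cl) :
  (forall mu, clCk 2 (C mu)) -> zero_curvature C -> clCk 2 S ->
  (forall x, clmul (S x) (T x) = one /\ clmul (T x) (S x) = one) ->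
  zero_curvature (fun mu x =>
    clmul (clmul (T x) (C mu x)) (S x) - clmul (T x) (clpartial mu S x)).
Proof.
move=> C2 curvC S2 ST mu nu x.
have dT l := clderiv_inv (fun y => (ST y).1) (fun y => (ST y).2) (clCk_deriv l x S2).
have dS l := clCk_deriv l x S2.
have dC l m := clCk_deriv l x (C2 m).
have ddS l m := clCk_deriv l x (clCk_partial m S2).
have dG l m := clderiv_partial (clderivD (clderivM (clderivM (dT l) (dC l m)) (dS l))
   (clderivN (clderivM (dT l) (ddS l m)))).
(* Symmetry of the second derivatives of S lets both halves share the letter Smn. *)
rewrite !dG (clpartial_comm mu nu x S2).
apply: etrans (gauge_curvatureE _ _ _ _ _ _ _ (ST x).1) _.
by rewrite curvC clmul0l clmul0r.
Qed.

End CliffordCalculus.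

Theorem theorem7 (R : realType) (p q : nat) :
  (forall (h C : 'I_(p + q) -> Rpq R p q -> cl R p q),
      clifford_field_vector h ->
      (forall mu x, in_clS (h mu x)) ->
      (forall mu x, in_clS (C mu x)) ->
      (forall mu, clCk 2 (h mu)) ->
      (forall mu, clCk 2 (C mu)) ->
      (forall mu nu x,
          clpartial mu (h nu) x - clcomm (C mu x) (h nu x) = 0) ->
      zero_curvature C)
  /\
  (forall (C : 'I_(p + q) -> Rpq R p q -> cl R p q)
          (S Sinv : Rpq R p q -> cl R p q),
      (forall mu x, in_clS (C mu x)) ->
      (forall mu, clCk 2 (C mu)) ->
      zero_curvature C ->
      clsmooth S ->
      (forall x, clmul (S x) (Sinv x) = clunit R p q /\
                 clmul (Sinv x) (S x) = clunit R p q) ->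
      (forall mu x, in_clS (clmul (Sinv x) (clpartial mu S x))) ->
      zero_curvature (fun mu x =>
        clmul (clmul (Sinv x) (C mu x)) (S x)
        - clmul (Sinv x) (clpartial mu S x))).
Proof.
split=> [h C hcl _ CS h2 C2 dh|C S Sinv _ C2 curvC Ssmooth SSinv _].
  exact: parallel_zero_curvature hcl CS h2 C2 dh.
exact: gauge_zero_curvature C2 curvC (Ssmooth 2) SSinv.
Qed.
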